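(* Let $(V,\mu)$ and $(E,\tau)$ be positive measure spaces, $M:V\times E\to\mathbb{R}$ a $(\mu\times\tau)$-measurable function, $wt:E\to\mathbb{R}$ a $\tau$-measurable function, $I\subseteq\mathbb{R}$ an interval, and $\varphi:I\to\mathbb{R}$ a function such that $f(t)=t\varphi(t)$ is convex on $I$. Suppose that: (i) $0<\mu(V)<\infty$; (ii) $0<s:=\int_E wt\,d\tau<\infty$; (iii) $\int_{V\times E}|M(v,e)|\,|wt(e)|\,d(\mu\times\tau)<\infty$; (iv) for some real number $c$, $\int_V M(v,e)\,d\mu(v)=c$ for almost all $e\in E$; (v) for almost all $v\in V$, $\delta(v):=\int_E M(v,e)\,wt(e)\,d\tau(e)\in I$; (vi) $\int_{V\times E}|\varphi(\delta(v))|\,|M(v,e)|\,|wt(e)|\,d(\mu\times\tau)<\infty$. Let $\bar\delta=\frac{1}{\mu(V)}\int_V\delta\,d\mu$. Then $$\frac1s\int_{V\times E}\varphi(\delta(v))\,M(v,e)\,wt(e)\,d(\mu\times\tau)\;\ge\;c\,\varphi(\bar\delta).$$ Further, if $f$ is strictly convex on $I$, then equality holds in this inequality if and only if $\delta(v)=\bar\delta$ for $\mu$-almost every $v\in V$.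
   Context: $\mu\times\tau$ denotes the product measure on $V\times E$. ''Almost all $e\in E$'' is with respect to $\tau$ and ''almost all $v\in V$'' is with respect to $\mu$. *)

(* Defs.v *)
From HB Require Import structures.
From mathcomp Require Import all_boot all_order all_algebra.
From mathcomp Require Import all_classical all_reals all_analysis.
Import Order.TTheory GRing.Theory Num.Theory.
Import numFieldNormedType.Exports.

Set Implicit Arguments.
Unset Strict Implicit.
Unset Printing Implicit Defensive.

Local Open Scope classical_set_scope.
Local Open Scope ring_scope.
Local Open Scope convex_scope.

(* Strict counterpart of the library's convex_function. *)
Definition strictly_convex_function (R : numFieldType) (E : lmodType R)
    (E' := convex_lmodType E) (D : set E') (f : E' -> R^o) :=
  forall t : {i01 R}, 0 < t%:num -> t%:num < 1 ->
    {in D &, forall x y : E', x != y -> f (x <| t |> y) < f x <| t |> f y}.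

(* The library's product measures "mu \x tau" and "mu \x^ tau" each need a
   sigma-finite factor.  For arbitrary measures, a product measure of mu and tau
   is any measure on the product sigma-algebra with the right value on
   measurable rectangles; if both mu and tau are sigma-finite it is unique
   (is_product_measure_unique below), and if mu is finite one always exists
   (is_product_measure2). *)
Definition is_product_measure d d' (V : measurableType d)
    (E : measurableType d') (R : realType)
    (mu : {measure set V -> \bar R}) (tau : {measure set E -> \bar R})
    (mutau : {measure set (V * E) -> \bar R}) :=
  forall (A : set V) (B : set E), measurable A -> measurable B ->
    mutau (A `*` B) = (mu A * tau B)%E.

Section product_measure_facts.
Context d d' (V : measurableType d) (E : measurableType d') (R : realType).

Lemma is_product_measure1 (mu : {measure set V -> \bar R})
    (tau : {sigma_finite_measure set E -> \bar R}) :
  is_product_measure mu tau (mu \x tau)%E.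
Proof. by move=> A B mA mB; exact: product_measure1E. Qed.

Lemma is_product_measure2 (mu : {sigma_finite_measure set V -> \bar R})
    (tau : {measure set E -> \bar R}) :
  is_product_measure mu tau (mu \x^ tau)%E.
Proof. by move=> A B mA mB; exact: product_measure2E. Qed.

Lemma is_product_measure_unique (mu : {sigma_finite_measure set V -> \bar R})
    (tau : {sigma_finite_measure set E -> \bar R})
    (mutau : {measure set (V * E) -> \bar R}) :
  is_product_measure mu tau mutau ->
  forall X, measurable X -> mutau X = (mu \x tau)%E X.
Proof. by move=> h X mX; rewrite (product_measure_unique h). Qed.

End product_measure_facts.

Section delta.
Context d d' (V : measurableType d) (E : measurableType d') (R : realType).
Variables (mu : {measure set V -> \bar R}) (tau : {measure set E -> \bar R}).
Variables (M : V * E -> R) (wt : E -> R).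

(* Rintegral is total: delta takes a junk value at those v where
   M (v, _) * wt is not tau-integrable. *)
Definition delta (v : V) : R := \int[tau]_e (M (v, e) * wt e).

Definition delta_bar : R := (fine (mu setT))^-1 * \int[mu]_v delta v.

End delta.

(* Main.v *)
Require Import Defs.
From HB Require Import structures.
From mathcomp Require Import all_boot all_order all_algebra.
From mathcomp Require Import all_classical all_reals all_analysis.
From mathcomp Require Import unstable measurable_realfun ring lra.
Import Order.TTheory GRing.Theory Num.Theory.
Import numFieldNormedType.Exports.

Set Implicit Arguments.
Unset Strict Implicit.
Unset Printing Implicit Defensive.

(* By Fubini, the integral of phi(delta(v)) M(v, e) wt(e) over V x E is that of
   f(delta(v)) over V, and the integral of delta over V is c * s by (iv).
   Jensen's inequality for f gives mu(V) f(delta_bar) <= int_V f(delta) dmu, and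
   mu(V) f(delta_bar) = c * s * phi(delta_bar).  Although tau is arbitrary, wt is
   integrable, so everything happens over V x {wt != 0}, where tau is
   sigma-finite and the product measure is therefore unique. *)

Local Open Scope classical_set_scope.
Local Open Scope ring_scope.

(** * Convex functions on a real interval: chords, support lines, measurability *)

Lemma convex_lmodR_convE (R : realType) (t : {i01 R}) (a b : R) :
  @conv R (convex_lmodType R^o) t a b = t%:num * a + (1 - t%:num) * b.
Proof. by []. Qed.

Section convex.
Context (R : realType) (I : set R) (f : R -> R).
Hypothesis hI : is_interval I.

(** [t] is the weight of [a] for which the convex combination of [a] and [b] equals [m]. *)
Lemma i01_ratio (a b m : R) : a < m -> m < b ->
  exists t : {i01 R}, [/\ t%:num = (b - m) / (b - a), 0 < t%:num & t%:num < 1].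
Proof.
move=> am mb.
have ba0 : 0 < b - a by lra.
have t0 : 0 < (b - m) / (b - a) by rewrite divr_gt0//; lra.
have t1 : (b - m) / (b - a) < 1 by rewrite ltr_pdivrMr// mul1r; lra.
have t01 : 0 <= (b - m) / (b - a) <= 1 by rewrite !ltW.
by exists (Itv01 (ltW t0) (ltW t1)).
Qed.

(** Multiplying the convexity inequality by [b - a] clears the denominators, which suits linear and
    nonlinear arithmetic. *)
Lemma convex_function_chord : @convex_function R R^o I f ->
  forall a b m, I a -> I b -> a < m -> m < b ->
  (b - a) * f m <= (b - m) * f a + (m - a) * f b.
Proof.
move=> cf a b m Ia Ib am mb; have [t [te t0 t1]] := i01_ratio am mb.
have ba0 : 0 < b - a by lra.
have := cf t a b (mem_set Ia) (mem_set Ib).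
rewrite !convex_lmodR_convE te.
have -> : (b - m) / (b - a) * a + (1 - (b - m) / (b - a)) * b = m.
  by field; rewrite gt_eqF.
have -> : (b - m) * f a + (m - a) * f b =
    (b - a) * ((b - m) / (b - a) * f a + (1 - (b - m) / (b - a)) * f b).
  by field; rewrite gt_eqF.
by rewrite ler_pM2l // convRE te.
Qed.

Lemma strictly_convex_function_chord : @strictly_convex_function R R^o I f ->
  forall a b m, I a -> I b -> a < m -> m < b ->
  (b - a) * f m < (b - m) * f a + (m - a) * f b.
Proof.
move=> cf a b m Ia Ib am mb; have [t [te t0 t1]] := i01_ratio am mb.
have ba0 : 0 < b - a by lra.
have ab : a != b by rewrite lt_eqF//; lra.
have := cf t t0 t1 a b (mem_set Ia) (mem_set Ib) ab.
rewrite !convex_lmodR_convE te.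
have -> : (b - m) / (b - a) * a + (1 - (b - m) / (b - a)) * b = m.
  by field; rewrite gt_eqF.
have -> : (b - m) * f a + (m - a) * f b =
    (b - a) * ((b - m) / (b - a) * f a + (1 - (b - m) / (b - a)) * f b).
  by field; rewrite gt_eqF.
by rewrite ltr_pM2l // convRE te.
Qed.

(** Take for [k] the supremum of the slopes of chords reaching [m] from the left. By convexity every
    chord leaving [m] to the right has at least the slope of each of these, so the supremum is
    finite and serves both sides. *)
Lemma convex_function_subgradient (m : R) : @convex_function R R^o I f ->
  (exists2 a, I a & a < m) -> (exists2 b, I b & m < b) ->
  exists k, forall t, I t -> f m + k * (t - m) <= f t.
Proof.
move=> cf [a Ia am] [b Ib mb].
pose S := [set (f m - f x) / (m - x) | x in [set x | I x /\ x < m]].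
have S_ub y : I y -> m < y -> ubound S ((f y - f m) / (y - m)).
  move=> Iy my _ [x [Ix xm] <-].
  have mx0 : 0 < m - x by lra.
  have ym0 : 0 < y - m by lra.
  rewrite ler_pdivrMr// mulrAC ler_pdivlMr//.
  have := convex_function_chord cf Ix Iy xm my; lra.
have S0 : S !=set0 by exists ((f m - f a) / (m - a)); exists a.
exists (sup S) => t It; have [tm|mt|->] := ltgtP t m; last by rewrite subrr mulr0 addr0.
- have : (f m - f t) / (m - t) <= sup S.
    apply: ub_le_sup; first by exists ((f b - f m) / (b - m)); exact: S_ub.
    by exists t.
  by rewrite ler_pdivrMr ?subr_gt0//; lra.
- have := ge_sup S0 (S_ub _ It mt).
  by rewrite ler_pdivlMr ?subr_gt0//; lra.
Qed.

(* At a second contact point the support line would lie above the graph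
   midway. *)
Lemma strictly_convex_subgradient_lt (m k : R) :
  @strictly_convex_function R R^o I f -> I m ->
  (forall t, I t -> f m + k * (t - m) <= f t) ->
  forall t, I t -> t != m -> f m + k * (t - m) < f t.
Proof.
move=> cf Im sup t It tm; rewrite lt_neqAle sup// andbT; apply/eqP => ft.
(* The contact points [m] and [t] are named in increasing order, so that one midpoint argument
   covers both cases. *)
wlog: / exists u v, [/\ I u, I v, u < v, f u = f m + k * (u - m) & f v = f m + k * (v - m)].
  apply; case: (ltgtP t m) tm => // tm _; [exists t, m|exists m, t]; split=> //; lra.
move=> [u [v [Iu Iv uv fu fv]]].
have uw : u < (u + v) / 2 by lra.
have wv : (u + v) / 2 < v by lra.
have := strictly_convex_function_chord cf Iu Iv uw wv.
have Iw : I ((u + v) / 2) by apply: (hI Iu Iv); rewrite !ltW.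
have := sup _ Iw; rewrite fu fv; set w := (_ + _) / 2 => h1 h2.
have vu0 : 0 < v - u by lra.
have := ler_wpM2l (ltW vu0) h1; nra.
Qed.

(** Convexity makes every sublevel set within [I] an interval, and the corresponding rays generate
    the Borel sets. *)
Lemma convex_function_measurable : @convex_function R R^o I f ->
  measurable_fun I f.
Proof.
move=> cf; apply: (measurability _ (RGenInftyO.measurableE R)).
move=> _ [_ [r ->] <-]; apply: is_interval_measurable => x y /=.
move=> [Ix]; rewrite /= in_itv/= => fx [Iy]; rewrite /= in_itv/= => fy z /andP[xz zy].
split; first by apply: (hI Ix Iy); rewrite xz.
rewrite /= in_itv/=.
move: xz; rewrite le_eqVlt => /predU1P[<-//|xz].
move: zy; rewrite le_eqVlt => /predU1P[->//|zy].
have := convex_function_chord cf Ix Iy xz zy.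
nra.
Qed.

End convex.

(** * Measurability of [phi] from that of [t * phi t] *)

Lemma measurable_invr (R : realType) :
  measurable_fun [set x : R | x != 0] (@GRing.inv R).
Proof.
apply: open_continuous_measurable_fun; first exact: open_neq.
by move=> x /set_mem; exact: inv_continuous.
Qed.

(** Away from 0 division by [t] recovers [phi]; the remaining point 0 is a measurable set on which
    [phi] is constant. *)
Lemma measurable_fun_divX (R : realType) (I : set R) (phi : R -> R) :
  measurable I -> measurable_fun I (fun t => t * phi t) -> measurable_fun I phi.
Proof.
move=> mI mf.
have -> : phi = (fun t => if t == 0 then phi 0 else (t * phi t) * t^-1).
  by apply/funext => t; case: eqVneq => [->//|t0]; rewrite mulrAC divff ?mul1r.
apply: measurable_fun_if => //.
- exact: measurable_fun_eqr.
- apply: measurable_funM; first by apply: measurable_funS mf.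
  apply: measurable_funS (@measurable_invr R); last by move=> x [_ /= /negbT].
  by apply: open_measurable; exact: open_neq.
Qed.

(** * Discarding a null set from an integral *)

Section null_set.
Local Open Scope ereal_scope.
Context d (T : measurableType d) (R : realType) (mu : {measure set T -> \bar R}).

Import HBNNSimple.

(** Valid for arbitrary nonnegative [f]: its integral is a supremum over simple functions below it,
    and cutting one of these to the complement of [N] keeps its integral. This serves for the
    composite of [phi] with [delta], which may fail to be measurable. *)
Lemma ge0_integral_setC_null (N : set T) (f : T -> \bar R) :
  measurable N -> mu N = 0 -> (forall x, 0 <= f x) ->
  \int[mu]_x f x = \int[mu]_(x in ~` N) f x.
Proof.
move=> mN N0 f0; have mD := measurableC mN.
have fD0 x : 0 <= (f \_ (~` N)) x by rewrite patchE; case: ifP.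
rewrite [RHS]integral_mkcond !ge0_integralTE//; apply/eqP; rewrite eq_le.
apply/andP; split; apply: ge_ereal_sup => _ /= [h hf <-].
- apply: ereal_sup_ubound; exists (proj_nnsfun h mD).
    move=> x; have := hf x; rewrite -mrestrict !patchE.
    by case: ifP.
  rewrite -[RHS]integralT_nnsfun (ge0_negligible_integral mN)//; last 2 first.
    by apply/measurable_EFinP.
    by move=> x _; rewrite lee_fin.
  by rewrite setTD integral_nnsfun// mrestrict.
- apply: ereal_sup_ubound; exists h => // x; apply: le_trans (hf x) _.
  by rewrite patchE; case: ifP.
Qed.

Lemma integral_setC_null (N : set T) (f : T -> \bar R) :
  measurable N -> mu N = 0 -> \int[mu]_x f x = \int[mu]_(x in ~` N) f x.
Proof.
move=> mN N0; rewrite integralE [RHS]integralE.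
by congr (_ - _); exact: ge0_integral_setC_null.
Qed.

End null_set.

(** * Restriction of a measure to a set, and sigma-finite supports *)

Section restriction.
Local Open Scope ereal_scope.
Context d (T : measurableType d) (R : realType) (mu : {measure set T -> \bar R}).
Context (D : set T) (mD : measurable D).

Lemma integral_mrestr (f : T -> \bar R) : (forall x, ~ D x -> f x = 0) ->
  \int[mrestr mu mD]_x f x = \int[mu]_x f x.
Proof.
move=> f0; have -> : f = f \_ D.
  by apply/funext => x; rewrite patchE; case: ifPn => // /negP; rewrite inE => /f0.
rewrite -!integral_mkcond; apply: eq_measure_integral => A _ AD.
by rewrite /= /mrestr setIidl.
Qed.

Lemma integrable_mrestr (f : T -> \bar R) : (forall x, ~ D x -> f x = 0) ->
  (mrestr mu mD).-integrable setT f <-> mu.-integrable setT f.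
Proof.
move=> f0; have absf0 x : ~ D x -> (abse \o f) x = 0 by move=> /f0 fx; rewrite /= fx abse0.
by split=> /integrableP[mf fi]; apply/integrableP; split=> //; move: fi;
  rewrite (integral_mrestr absf0).
Qed.

(** The complement of [D] is null for the restricted measure, so it can be added to each set of a
    cover of [D]. *)
Lemma sigma_finite_mrestr : sigma_finite D mu -> sigma_finite setT (mrestr mu mD).
Proof.
move=> [F DF mF]; exists (fun n => F n `|` ~` D).
  by apply/esym/seteqP; split => // x _; have [|Dx] := pselect (D x);
    [rewrite DF => -[n _ Fx]; exists n => //; left|exists 0%N => //; right].
move=> n; have [mFn Fnoo] := mF n; split.
  by apply: measurableU => //; exact: measurableC.
rewrite /mrestr setIUl setICl setU0.
by apply: le_lt_trans Fnoo; rewrite le_measure ?inE//; exact: measurableI.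
Qed.

End restriction.

(** The support is the union of the sets where the absolute value of [f] is at least [1 / (n + 1)],
    each of finite measure by Markov's inequality. *)
Lemma sigma_finite_support d (T : measurableType d) (R : realType)
    (mu : {measure set T -> \bar R}) (f : T -> R) :
  mu.-integrable setT (EFin \o f) -> sigma_finite [set x | f x != 0] mu.
Proof.
move=> /integrableP[mf fi].
exists (fun n => [set x | (n.+1%:R^-1%:E <= `|(f x)%:E|)%E]).
  apply/seteqP; split => [x /= fx0|x [n _] /=]; last first.
    by apply: contraTneq => ->; rewrite normr0 lee_fin -ltNge.
  (* The integer part [n] of the inverse satisfies [|f x|^-1 < n + 1]. *)
  exists (Num.truncn `|f x|^-1) => //=.
  rewrite lee_fin invf_ple ?posrE ?normr_gt0//.
  exact/ltW/truncnS_gt.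
move=> n; rewrite -[X in measurable X]setTI -[X in mu X]setTI; split.
  by apply: emeasurable_fun_c_infty => //; exact: measurableT_comp.
have n0 : 0 < n.+1%:R^-1 :> R by rewrite invr_gt0.
have := le_integral_abse mu measurableT mf n0.
move=> /le_lt_trans /(_ fi); rewrite !ltey; apply: contra_neq => ->.
by rewrite gt0_muley ?lte_fin.
Qed.

(** * Real-valued versions of integrable extended-real functions *)

Section fine.
Context d (T : measurableType d) (R : realType) (mu : {measure set T -> \bar R}).
Context (f : T -> \bar R).
Hypothesis fi : mu.-integrable setT f.

Let mf : measurable_fun setT (fine \o f).
Proof. by apply: measurableT_comp => //; exact: measurable_int fi. Qed.

(** [fine] sends infinite values to 0, so it never increases the absolute value. *)
Lemma integrable_fine : mu.-integrable setT (EFin \o (fine \o f)).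
Proof.
apply: le_integrable fi => //; first exact/measurable_EFinP.
by move=> x _ /=; case: (f x) => //= *; rewrite ?normr0 ?leey.
Qed.

Lemma Rintegral_fine : \int[mu]_x fine (f x) = fine (\int[mu]_x f x)%E.
Proof.
congr fine; apply: ae_eq_integral => //; first exact/measurable_EFinP.
  exact: measurable_int fi.
by have := integrable_ae measurableT fi; apply: filterS => x fx /fx /fineK.
Qed.

End fine.

(** * Fubini's theorem for integrands vanishing off a sigma-finite set of [E] *)

Section fubini.
Local Open Scope ereal_scope.
Context d d' (V : measurableType d) (E : measurableType d') (R : realType).
Context (mu : {sigma_finite_measure set V -> \bar R}) (tau : {measure set E -> \bar R})
  (mutau : {measure set (V * E) -> \bar R}).
Hypothesis hmutau : is_product_measure mu tau mutau.
Context (D : set E) (mD : measurable D) (sD : sigma_finite D tau).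

Let tauD0 : {measure set E -> \bar R} := mrestr tau mD.

(** Bundles the restricted measure with its sigma-finiteness, so that the Fubini theorems for
    sigma-finite measures apply to it. *)
Let tauD : {sigma_finite_measure set E -> \bar R} :=
  HB.pack (Measure.sort tauD0)
    (Measure_isSigmaFinite.Build _ _ _ tauD0 (sigma_finite_mrestr mD sD)).

Variable g : V * E -> \bar R.
Hypotheses (gi : mutau.-integrable setT g) (g0 : forall v e, ~ D e -> g (v, e) = 0).

Let mVD : measurable ([set: V] `*` D) := measurableX measurableT mD.

Let g0' z : ~ ([set: V] `*` D) z -> g z = 0.
Proof. by case: z => v e zD; apply: g0 => De; exact: zD. Qed.

(** Both measures give the rectangle on [A] and [B] the value [mu A * tau (B]&[D)], and for
    sigma-finite factors this determines the product. *)
Let prodE X : measurable X -> (mu \x tauD) X = mrestr mutau mVD X.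
Proof.
apply: product_measure_unique => A B mA mB /=.
rewrite /mrestr -setXI setIT hmutau//.
exact: measurableI.
Qed.

Let prod_int f : \int[mu \x tauD]_z f z = \int[mrestr mutau mVD]_z f z.
Proof. by apply: eq_measure_integral => A mA _; exact: prodE. Qed.

Let gi' : (mu \x tauD).-integrable setT g.
Proof.
have /integrableP[mg gfi] := (integrable_mrestr _ mVD g0').2 gi.
by apply/integrableP; split=> //; rewrite prod_int.
Qed.

Lemma product_measure_ae_integrable1 :
  {ae mu, forall v, tau.-integrable setT (fun e => g (v, e))}.
Proof.
have := ae_integrable1 gi'; apply: filterS => v.
by move/(integrable_mrestr _ mD (g0 v)).1.
Qed.

Lemma product_measure_ae_integrable2 :
  {ae tau, forall e, mu.-integrable setT (fun v => g (v, e))}.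
Proof.
have [N [mN N0 gN]] := ae_integrable2 gi'.
(* Off [D] the section of [g] is zero, hence integrable, so only the part of [N] in [D] is
   exceptional, and that part is [tau]-null. *)
exists (N `&` D); split => //; first exact: measurableI.
move=> e /= ge; split; first exact: gN.
apply: contrapT => De; apply: ge.
rewrite /= (_ : (fun v => g (v, e)) = cst 0); first exact: integrable0.
by apply/funext => v; rewrite g0.
Qed.

Let FE v : \int[tau]_e g (v, e) = \int[tauD]_e g (v, e).
Proof. by rewrite -(integral_mrestr _ mD (g0 v)). Qed.

Lemma product_measure_integrable1 :
  mu.-integrable setT (fun v => \int[tau]_e g (v, e)).
Proof. by under eq_fun do rewrite FE; exact: (integrable_fubini_F gi'). Qed.

Lemma product_measure_measurable2 :
  measurable_fun setT (fun e => \int[mu]_v g (v, e)).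
Proof. exact: measurable_fubini_G gi'. Qed.

Lemma product_measure_integral12 :
  \int[mu]_v \int[tau]_e g (v, e) = \int[mutau]_z g z.
Proof.
under eq_integral do rewrite FE.
by rewrite integral12_prod_meas1// prod_int integral_mrestr.
Qed.

Lemma product_measure_integral21 :
  \int[tau]_e \int[mu]_v g (v, e) = \int[mutau]_z g z.
Proof.
rewrite -(integral_mrestr _ mD); last first.
  by move=> e De; rewrite integral0_eq// => v _; rewrite g0.
by rewrite (integral21_prod_meas1 gi') prod_int integral_mrestr.
Qed.

End fubini.

(** * Integrals of almost everywhere nonnegative functions *)

Section ae_ge0.
Context d (T : measurableType d) (R : realType) (mu : {measure set T -> \bar R}).
Context (h : T -> R).
Hypotheses (hi : mu.-integrable setT (EFin \o h)) (h0 : {ae mu, forall x, 0 <= h x}).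

Let mh : measurable_fun setT (EFin \o h) := measurable_int mu hi.

Let int_abs : (\int[mu]_x (h x)%:E = \int[mu]_x `|(h x)%:E|)%E.
Proof.
apply: ae_eq_integral => //; first exact: measurableT_comp.
by apply: filterS h0 => x /= hx _; rewrite ger0_norm.
Qed.

Lemma ae_ge0_Rintegral_ge0 : 0 <= \int[mu]_x h x.
Proof. by rewrite /Rintegral fine_ge0// int_abs integral_ge0. Qed.

Lemma ae_ge0_Rintegral_eq0 : \int[mu]_x h x = 0 -> {ae mu, forall x, h x = 0}.
Proof.
move=> ih0.
have : (\int[mu]_x `|(EFin \o h) x| = 0)%E.
  rewrite -int_abs -(fineK (integrable_fin_num measurableT hi)).
  by rewrite -[fine _]/(\int[mu]_x h x) ih0.
by move/(ae_eq_integral_abs mu measurableT mh); apply: filterS => x /(_ I) [].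
Qed.

End ae_ge0.

(** * Jensen's inequality and its equality case *)

Section jensen.
Context d (T : measurableType d) (R : realType) (mu : {finite_measure set T -> \bar R}).
Hypothesis mu_gt0 : (0 < mu [set: T])%E.
(** [Y] stands in for the composite of [f] with [X], which may fail to be measurable since [f] is
    arbitrary outside [I]. *)
Context (I : set R) (f : R -> R) (X Y : T -> R).
Hypotheses (hI : is_interval I) (cf : @convex_function R R^o I f).
Hypotheses (Xi : mu.-integrable setT (EFin \o X)) (Yi : mu.-integrable setT (EFin \o Y)).
Hypotheses (XI : {ae mu, forall x, I (X x)}) (XY : {ae mu, forall x, Y x = f (X x)}).

Let c := fine (mu [set: T]).
Let m := c^-1 * \int[mu]_x X x.

Let c_gt0 : 0 < c.
Proof. by rewrite fine_gt0// mu_gt0 ltey_eq fin_num_measure. Qed.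

Let cst_int k : mu.-integrable setT (EFin \o (fun=> k : R)).
Proof. exact: finite_measure_integrable_cst. Qed.

Let intX : \int[mu]_x X x = c * m.
Proof. by rewrite /m mulrA divff ?mul1r// gt_eqF. Qed.

Let int_cst k : \int[mu]_x k = k * c.
Proof. by rewrite Rintegral_cst. Qed.

Let Xmi : mu.-integrable setT (EFin \o (fun x => X x - m)).
Proof. by have := integrableB measurableT Xi (cst_int m). Qed.

Let intXm : \int[mu]_x (X x - m) = 0.
Proof. by rewrite RintegralB// int_cst intX mulrC subrr. Qed.

(* If I lies on one side of m, then X - m has constant sign and zero integral;
   this also covers the case where m is not in I. *)
Let one_sided : (forall t, I t -> m <= t) \/ (forall t, I t -> t <= m) ->
  {ae mu, forall x, X x = m}.
Proof.
case=> Im.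
- have : {ae mu, forall x, 0 <= X x - m}.
    by apply: filterS XI => x /Im; rewrite subr_ge0.
  move=> /(ae_ge0_Rintegral_eq0 Xmi) /(_ intXm).
  by apply: filterS => x /eqP; rewrite subr_eq0 => /eqP.
- have Ni : mu.-integrable setT (EFin \o (fun x => m - X x)).
    by have := integrableB measurableT (cst_int m) Xi.
  have : {ae mu, forall x, 0 <= m - X x}.
    by apply: filterS XI => x /Im; rewrite subr_ge0.
  have iN : \int[mu]_x (m - X x) = 0.
    by rewrite RintegralB// int_cst intX mulrC subrr.
  move=> /(ae_ge0_Rintegral_eq0 Ni) /(_ iN).
  by apply: filterS => x /eqP; rewrite subr_eq0 => /eqP.
Qed.

Lemma jensen_ae_cst : {ae mu, forall x, X x = m} -> \int[mu]_x Y x = c * f m.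
Proof.
move=> Xm; rewrite mulrC -int_cst; congr fine; apply: ae_eq_integral => //.
  exact: measurable_int Yi.
by move: Xm XY; apply: filterS2 => x -> + _ => ->.
Qed.

Let split_interval : (forall t, I t -> m <= t) \/ (forall t, I t -> t <= m) \/
  ((exists2 a, I a & a < m) /\ (exists2 b, I b & m < b)).
Proof.
have [?|/existsNP[a /not_implyP[Ia /negP]]] :=
  pselect (forall t, I t -> m <= t); first by left.
rewrite -ltNge => am; right.
have [?|/existsNP[b /not_implyP[Ib /negP]]] :=
  pselect (forall t, I t -> t <= m); first by left.
by rewrite -ltNge => mb; right; split; [exists a|exists b].
Qed.

(** Excess of [Y] over the line of slope [k] through the point of the graph of [f] at [m]; almost
    everywhere nonnegative when that line supports [f]. *)
Let gap k x := Y x - (f m + k * (X x - m)).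

Let gap_int k : mu.-integrable setT (EFin \o gap k).
Proof.
have := integrableD measurableT (cst_int (f m)) (integrableZl measurableT k Xmi).
by move=> /(integrableB measurableT Yi).
Qed.

(** The linear term drops out because [X - m] has integral zero. *)
Let int_gap k : \int[mu]_x gap k x = \int[mu]_x Y x - c * f m.
Proof.
have kXi := integrableZl measurableT k Xmi.
rewrite /gap RintegralB//; last exact: (integrableD measurableT (cst_int (f m)) kXi).
by rewrite RintegralD// int_cst RintegralZl// intXm mulr0 addr0 [f m * _]mulrC.
Qed.

(** With points of [I] on both sides of [m], integrate the inequality given by a support line at
    [m]. Otherwise [X] is almost everywhere [m] and equality holds. *)
Lemma jensen : c * f m <= \int[mu]_x Y x.
Proof.
have [Im|[Im|[am mb]]] := split_interval.
- by rewrite jensen_ae_cst//; apply: one_sided; left.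
- by rewrite jensen_ae_cst//; apply: one_sided; right.
have [k hk] := convex_function_subgradient cf am mb.
rewrite -subr_ge0 -(int_gap k); apply: ae_ge0_Rintegral_ge0 => //.
by apply: filterS2 XI XY => x /hk hkx YX; rewrite /gap YX subr_ge0.
Qed.

(** Equality gives the nonnegative gap integral zero, so it vanishes almost everywhere; under strict
    convexity the support line meets the graph only at [m]. *)
Lemma jensen_eq : @strictly_convex_function R R^o I f ->
  \int[mu]_x Y x = c * f m <-> {ae mu, forall x, X x = m}.
Proof.
move=> scf; split; last exact: jensen_ae_cst.
have [Im _|[Im _|[am mb]]] := split_interval.
- by apply: one_sided; left.
- by apply: one_sided; right.
have [k hk] := convex_function_subgradient cf am mb.
move=> /eqP; rewrite -subr_eq0 -(int_gap k) => /eqP gap0.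
have Im : I m.
  by case: am mb => [a Ia am] [b Ib mb]; apply: (hI Ia Ib); rewrite !ltW.
have gap_ge0 : {ae mu, forall x, 0 <= gap k x}.
  by apply: filterS2 XI XY => x /hk hkx YX; rewrite /gap YX subr_ge0.
have := ae_ge0_Rintegral_eq0 (gap_int k) gap_ge0 gap0.
apply: filterS3 XI XY => x IX YX; rewrite /gap YX => /eqP; rewrite subr_eq0 => /eqP fX.
apply/eqP/negPn/negP => Xm.
by have := strictly_convex_subgradient_lt hI scf Im hk IX Xm; rewrite fX ltxx.
Qed.

End jensen.

(** * The weighted integral inequality and its equality case *)

Lemma finite_measureE d (T : measurableType d) (R : realType)
    (mu : {measure set T -> \bar R}) : (mu [set: T] < +oo)%E ->
  exists nu : {finite_measure set T -> \bar R}, mu = nu.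
Proof.
(* Restricting to the whole space returns [mu] itself, now carrying the structure of a finite
   measure. *)
move=> muoo; exists (mfrestr measurableT muoo).
by apply: eq_measure; apply/funext => A; rewrite /= /mfrestr /mrestr setIT.
Qed.

Unset Implicit Arguments.

Theorem theorem2p1 (R : realType) (d d' : measure_display)
  (V : measurableType d) (E : measurableType d')
  (mu : {measure set V -> \bar R}) (tau : {measure set E -> \bar R})
  (mutau : {measure set (V * E) -> \bar R})
  (hmutau : is_product_measure mu tau mutau)
  (M : V * E -> R) (mM : measurable_fun [set: V * E] M)
  (wt : E -> R) (mwt : measurable_fun [set: E] wt)
  (I : set R) (hI : is_interval I)
  (phi : R -> R) (f := fun t : R => t * phi t)
  (hf : @convex_function R R^o I f)
  (hmu : (0 < mu [set: V] < +oo)%E)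
  (hwt : (0 < \int[tau]_e (wt e)%:E < +oo)%E)
  (s := \int[tau]_e wt e)
  (hM : (\int[mutau]_z (`|M z| * `|wt z.2|)%:E < +oo)%E)
  (c : R)
  (hc : {ae tau, forall e, (\int[mu]_v (M (v, e))%:E = c%:E)%E})
  (hdelta : {ae mu, forall v, I (delta tau M wt v)})
  (hphi : (\int[mutau]_z
    (`|phi (delta tau M wt z.1)| * `|M z| * `|wt z.2|)%:E < +oo)%E) :
  (s^-1 * \int[mutau]_z (phi (delta tau M wt z.1) * M z * wt z.2)
     >= c * phi (delta_bar mu tau M wt))
  /\
  (@strictly_convex_function R R^o I f ->
     (s^-1 * \int[mutau]_z (phi (delta tau M wt z.1) * M z * wt z.2)
        = c * phi (delta_bar mu tau M wt)
      <-> {ae mu, forall v, delta tau M wt v = delta_bar mu tau M wt})).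
Proof.
have [/andP[mu_gt0 mu_lty] /andP[wt_gt0 wt_lty]] := (hmu, hwt).
have [nu mu_nu] := finite_measureE mu_lty; subst mu.
set dl := delta tau M wt; set m := delta_bar nu tau M wt.
have wti : tau.-integrable setT (EFin \o wt).
  apply/integrableP; split; first exact/measurable_EFinP.
  (* A finite signed integral forces finite positive and negative parts, because a difference of two
     infinities counts as infinite. *)
  rewrite (integral_fin_num_abs tau measurableT mwt) fin_real//.
  by rewrite (lt_trans _ wt_gt0).
have s_gt0 : 0 < s by rewrite /s /Rintegral fine_gt0.
pose D := [set e | wt e != 0].
have mD : measurable D.
  by have := emeasurable_neq measurableT (measurable_int _ wti) 0; rewrite setTI.
have sD : sigma_finite D tau := sigma_finite_support wti.
have DC e : ~ D e -> wt e = 0 by move/negP/negPn/eqP.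
have mw : measurable_fun [set: V * E] (fun z => wt z.2) by exact: measurableT_comp.
pose g z := (M z * wt z.2)%:E.
have gi : mutau.-integrable setT g.
  apply/integrableP; split; first exact/measurable_EFinP/measurable_funM.
  by under eq_integral do rewrite /= normrM.
have g0 v e : ~ D e -> g (v, e) = 0%E by move/DC => we; rewrite /g /= we mulr0.
have dlE : dl = fun v => fine (\int[tau]_e g (v, e)) by [].
have Fi := product_measure_integrable1 hmutau mD sD gi g0.
have dli : nu.-integrable setT (EFin \o dl) := integrable_fine Fi.
have mdl : measurable_fun setT dl by exact/measurable_EFinP/(measurable_int _ dli).
(* After exchanging the order of integration, the inner integral over [V] is [c * wt e] for almost
   every [e]. *)
have int_dl : \int[nu]_v dl v = c * s.
  rewrite dlE (Rintegral_fine Fi) (product_measure_integral12 hmutau mD sD gi g0).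
  rewrite -(product_measure_integral21 hmutau mD sD gi g0).
  rewrite -RintegralZl//; congr fine; apply: ae_eq_integral => //.
  - exact: (product_measure_measurable2 hmutau mD sD gi g0).
  - exact/measurable_EFinP/measurable_funM.
  apply: filterS hc => e Mc _.
  (* Integrability of this section follows from its integral being the finite number [c]. *)
  have Mi : nu.-integrable setT (fun v => (M (v, e))%:E).
    apply/integrableP; split; first exact/measurable_EFinP/measurableT_comp.
    by rewrite integral_fin_num_abs ?Mc//; exact: measurableT_comp.
  by rewrite EFinM -Mc -integralZr//; under eq_integral do rewrite /g EFinM.
have mI := is_interval_measurable hI.
(* phi is arbitrary outside I, so phi \o dl need not be measurable; it agrees
   with phiI \o dl off the null set N. *)
pose phiI := phi \_ I.
have mphi := measurable_fun_divX mI (convex_function_measurable hI hf).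
have mphiI : measurable_fun setT (phiI \o dl).
  exact: (measurableT_comp ((measurable_restrictT _ mI).1 mphi) mdl).
pose N := dl @^-1` (~` I).
have mN : measurable N by rewrite -[N]setTI; apply: mdl => //; exact: measurableC.
have N0 : (nu : {measure set V -> \bar R}) N = 0%E by apply/negligibleP.
pose NE := N `*` [set: E].
have mNE : measurable NE by exact: measurableX.
(* The product [0 * tau E] is 0 even if [tau E] is infinite. *)
have NE0 : mutau NE = 0%E by rewrite hmutau// N0 mul0e.
have phiIE z : ~ NE z -> phiI (dl z.1) = phi (dl z.1).
  move=> zN; rewrite /phiI patchE mem_set//.
  by apply: contrapT => dlI; apply: zN.
pose k z := (phiI (dl z.1) * M z * wt z.2)%:E.
(* The parameter [h] allows two uses: the absolute value, for integrability, and the plain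
   embedding, for the integral itself. *)
have int_k (h : R -> \bar R) :
    (\int[mutau]_z h (phi (dl z.1) * M z * wt z.2)%R =
     \int[mutau]_z h (phiI (dl z.1) * M z * wt z.2)%R)%E.
  rewrite (integral_setC_null _ mNE NE0) [RHS](integral_setC_null _ mNE NE0).
  by apply: eq_integral => z /set_mem /phiIE ->.
have ki : mutau.-integrable setT k.
  apply/integrableP; split.
    apply/measurable_EFinP/measurable_funM => //; apply: measurable_funM => //.
    exact: (measurableT_comp mphiI).
  rewrite -(int_k (fun r => `|r%:E|%E)).
  by under eq_integral do rewrite /= !normrM.
have k0 v e : ~ D e -> k (v, e) = 0%E by move/DC => we; rewrite /k /= we mulr0.
have Gi := product_measure_integrable1 hmutau mD sD ki k0.
pose Y v := fine (\int[tau]_e k (v, e)).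
have Yi : nu.-integrable setT (EFin \o Y) := integrable_fine Gi.
have int_Y : \int[nu]_v Y v = \int[mutau]_z (phi (dl z.1) * M z * wt z.2).
  rewrite (Rintegral_fine Gi) (product_measure_integral12 hmutau mD sD ki k0).
  by rewrite /Rintegral (int_k EFin).
(* For fixed [v] the factor [phi (dl v)] is constant in [e]; as almost every section of [g] is
   integrable, it can be pulled out, leaving [phi (dl v) * dl v]. *)
have Yf : {ae nu, forall v, Y v = f (dl v)}.
  have gvi := product_measure_ae_integrable1 hmutau mD sD gi g0.
  apply: filterS2 hdelta gvi => v Iv gv.
  rewrite /f mulrC -[dl v]/(\int[tau]_e (M (v, e) * wt e)) -RintegralZl//.
  by congr fine; apply: eq_integral => e _; rewrite /k /phiI patchE mem_set//= mulrA.
have nu_gt0 : 0 < fine (nu setT) by apply: fine_gt0.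
have nu_m : fine (nu setT) * m = c * s.
  by rewrite -int_dl /m /delta_bar mulrA divff ?mul1r// gt_eqF.
have rhs : c * phi m = s^-1 * (fine (nu setT) * f m).
  by rewrite /f [_ * (m * _)]mulrA nu_m; field; rewrite gt_eqF.
rewrite -int_Y rhs; split.
  rewrite ler_pM2l ?invr_gt0//.
  exact: (jensen mu_gt0 hf dli Yi hdelta Yf).
move=> scf; rewrite -(jensen_eq mu_gt0 hI hf dli Yi hdelta Yf scf).
by split=> [/mulfI|->//]; apply; rewrite invr_eq0 gt_eqF.
Qed.
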